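(* Fix constants $\alpha>0$, $\beta>0$, $\theta>0$ and $\gamma_P>2$. Let $f(n):=n^{2/3}\ln^{1/3}n$, $s:=\min\{\lceil\alpha f(n)\rceil,n-1\}$ and $g:=(\beta s\ln(\theta s))^{1/2}$. Suppose $s<n-1$ and $1<\theta s\le n$. Let $c_{nk}$ be the number of comparisons made by the nonrecursive SELECT on an input list of size $n$ with rank $k$, and set $$\hat\gamma_P:=(4\gamma_P+2)(\beta/\alpha)^{1/2}+(2\gamma_P-1)\big[\alpha+1/f(n)\big].$$ Then $$\mathrm{P}\big[c_{nk}\le n+\min\{k,n-k\}+\hat\gamma_P f(n)\big]\ge1-4(\alpha\theta)^{-2\beta}n^{-4\beta/3}\ln^{-2\beta/3}n.$$ Moreover, if $\beta\ge1/4$, then $$\mathrm{E}\,c_{nk}\le n+\min\{k,n-k\}+\big(\hat\gamma_P+(4\gamma_P+2)(\alpha\theta)^{-2\beta}\big)f(n).$$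
   Context: Nonrecursive SELECT. The input is a list $X=(x_1,\dots,x_n)$ of elements of a totally ordered set (repeated values allowed) and an integer $1\le k\le n$. Let $\mathcal R$ be a deterministic routine that finds the $i$th smallest of any $m$ elements using at most $\gamma_P m$ comparisons. 1. Choose a set $I$ of $s$ positions uniformly at random among all $s$-subsets of $\{1,\dots,n\}$. The sample is $S=(x_j)_{j\in I}$ with sorted elements $y_1^*\le\dots\le y_s^*$. 2. Set $i_u:=\max\{\lceil ks/n-g\rceil,1\}$ and $i_v:=\min\{\lceil ks/n+g\rceil,s\}$. Compute $u:=y_{i_u}^*$ and $v:=y_{i_v}^*$ using $\mathcal R$ at most twice on at most $s$ elements, so this step uses at most $2\gamma_P s$ comparisons. 3. Partition. Each $x_j$ with $j\notin I$ is compared with the pivots. - If $k<n/2$: $x_j$ is compared with $v$ first, and with $u$ only if $x_j<v$ and $u<v$. - If $k\ge n/2$: $x_j$ is compared with $u$ first, and with $v$ only if $x_j>u$ and $u<v$. Sample elements are not compared. Hence this step uses $c$ comparisons, where $c=n-s$ if $u=v$, $c=(n-s)+|\{j\notin I:x_j<v\}|$ if $u<v$ and $k<n/2$, and $c=(n-s)+|\{j\notin I:x_j>u\}|$ if $u<v$ and $k\ge n/2$. 4. Let $L=\{x<u\}$, $U=\{x=u\}$, $M=\{u<x<v\}$ and $R=\{x>v\}$. - If $|L|<k\le|L\cup U|$, return $u$; if $|L\cup U\cup M|<k\le n-|R|$, return $v$. In either case set $\hat n:=0$. - Otherwise let $\hat X$ be $L$ if $k\le|L|$, else $R$ if $n-|R|<k$,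 else $M$. Let $\hat n:=|\hat X|$ and find the answer in $\hat X$ with $\mathcal R$, using at most $\gamma_P\hat n$ comparisons. The total count $c_{nk}$ consists of the comparisons in steps 2, 3 and 4, so $c_{nk}\le 2\gamma_P s+c+\gamma_P\hat n$. $\mathrm{P}$ and $\mathrm{E}$ are with respect to the random sample. *)

(* Defs.v *)
From HB Require Import structures.
From mathcomp Require Import all_boot all_order all_algebra.
From mathcomp Require Import reals exp.
Set Implicit Arguments. Unset Strict Implicit. Unset Printing Implicit Defensive.
Import Order.TTheory GRing.Theory Num.Theory.
Local Open Scope ring_scope.

Section Defs.
Variable R : realType.

Definition fN (n : nat) : R := (n%:R) `^ (2 / 3) * (ln (n%:R)) `^ (1 / 3).

Definition ssize (alpha : R) (n : nat) : nat :=
  minn `|Num.ceil (alpha * fN n)|%N n.-1.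

Definition gap (beta theta : R) (s : nat) : R :=
  Num.sqrt (beta * s%:R * ln (theta * s%:R)).

Definition idx_u (n k s : nat) (g : R) : nat :=
  `|Num.max (Num.ceil (k%:R * s%:R / n%:R - g)) 1%Z|%N.
Definition idx_v (n k s : nat) (g : R) : nat :=
  `|Num.min (Num.ceil (k%:R * s%:R / n%:R + g)) (s%:Z)|%N.

Definition gammahat (alpha beta gammaP : R) (n : nat) : R :=
  (4 * gammaP + 2) * Num.sqrt (beta / alpha)
  + (2 * gammaP - 1) * (alpha + 1 / fN n).

Definition prob (n s : nat) (E : {set 'I_n} -> bool) : R :=
  #|[set I : {set 'I_n} | (#|I| == s) && E I]|%:R / 'C(n, s)%:R.

Definition expect (n s : nat) (F : {set 'I_n} -> nat) : R :=
  (\sum_(I : {set 'I_n} | #|I| == s) (F I)%:R) / 'C(n, s)%:R.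
End Defs.

Local Close Scope ring_scope.

(* The comparison count c_{nk} of the nonrecursive SELECT, for input list X
   (of size n), rank k, random sample positions I, sample indices iu, iv.
   cost2 S iu iv = comparisons used by R in step 2 (on the sample sequence S);
   costR Y i     = comparisons used by R to find the i-th smallest of Y
                   (deterministic, so a function of its input). *)
Definition select_count {d} {T : orderType d}
    (cost2 : seq T -> nat -> nat -> nat) (costR : seq T -> nat -> nat)
    (n k iu iv : nat) (X : seq T) (I : {set 'I_n}) : nat :=
  match X with
  | [::] => 0
  | x0 :: _ =>
    let S := [seq nth x0 X (nat_of_ord i) | i <- enum I] in
    let Ys := sort (fun a b => (a <= b)%O) S in
    let u := nth x0 Ys iu.-1 in
    let v := nth x0 Ys iv.-1 in
    let NS := [seq nth x0 X (nat_of_ord i) | i <- enum (~: I)] in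
    let c := if u == v then n - size S
             else if 2 * k < n then (n - size S) + count (fun x => (x < v)%O) NS
             else (n - size S) + count (fun x => (u < x)%O) NS in
    let nL := count (fun x => (x < u)%O) X in
    let nU := count (fun x => x == u) X in
    let nM := count (fun x => (u < x)%O && (x < v)%O) X in
    let nR := count (fun x => (v < x)%O) X in
    let c4 :=
      if (nL < k <= nL + nU) || (nL + nU + nM < k <= n - nR) then 0
      else if k <= nL then costR (filter (fun x => (x < u)%O) X) k
      else if n - nR < k then costR (filter (fun x => (v < x)%O) X) (k - (n - nR))
      else costR (filter (fun x => (u < x)%O && (x < v)%O) X) (k - (nL + nU)) in
    cost2 S iu iv + c + c4
  end.

Arguments select_count {d T} cost2 costR n k iu iv X I.
Arguments fN {R} n.
Arguments ssize {R} alpha n.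
Arguments gap {R} beta theta s.
Arguments idx_u {R} n k s g.
Arguments idx_v {R} n k s g.
Arguments gammahat {R} alpha beta gammaP n.
Arguments prob {R} n s E.
Arguments expect {R} n s F.

(* Main.v *)
(* The number of sampled positions in a fixed set of positions is hypergeometric,
   so it falls g below its mean with probability at most exp(-2 g^2 / s): its
   generating function is dominated by the binomial one, and Hoeffding's lemma
   applies.  With Delta = g n / s, each of the following failures is such a
   deviation, for a set of the form {x < t} or {x > t}:
     k <= #{x < u} although k > Delta,         #{x > u} > n - k + 2 Delta,
     n - k < #{x > v} although n - k > Delta,  #{x < v} > k + 2 Delta.
   The pivots u and v are random, but sets {x < t} form a chain, so it suffices
   to control the smallest one having the required number of elements.  Without
   failure, step 3 costs at most n - s + min(k, n - k) + 2 Delta and step 4 deals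
   with at most 4 Delta elements; a failure costs at most n more in each, and
   step 3 is affected by two of the four failures only. *)

Require Import Defs.
From HB Require Import structures.
From mathcomp Require Import all_boot all_order all_algebra.
From mathcomp Require Import classical_sets reals topology normedtype sequences.
From mathcomp Require Import derive realfun exp.
From mathcomp Require Import ring lra zify.
(* Imported again: classical_sets and topology shadow names of these files. *)
From mathcomp Require Import seq fintype finset.
Import Order.TTheory GRing.Theory Num.Theory.
Import numFieldNormedType.Exports.
Local Open Scope ring_scope.

(** * Hoeffding's lemma for a Bernoulli variable *)

Lemma le_is_derive_ge0 (R : realType) (f df : R -> R) (h : R) :
  (forall x : R, is_derive x (1 : R) f (df x)) -> (forall x, 0 <= x -> 0 <= df x) ->
  0 <= h -> f 0 <= f h.
Proof.
move=> fd df0 h0.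
have fcont : {within `[0, +oo[, continuous f}%classic.
  apply: continuous_subspaceT => x.
  by apply/differentiable_continuous/derivable1_diffP; case: (fd x).
apply: (ger0_derive1_ndecry _ _ fcont (lexx 0) h0).
- by move=> x _; case: (fd x).
- by move=> x; rewrite in_itv/= andbT derive1E => /ltW/df0; case: (fd x) => _ ->.
Qed.

(** With D(x) = 1 - p + p e^x, the function exp(-(p x + x^2/8)) D(x) equals 1 at 0 and is
    nonincreasing for x >= 0. Its derivative has the sign of -tau, where tau = p + x/4 - D'/D and
    D'/D = 1 - (1 - p)/D. Moreover tau(0) = 0 and tau' = 1/4 - (1 - p) p e^x / D^2 >= 0, because D^2
    >= 4 (1 - p) p e^x. *)
Lemma hoeffding_lemma (R : realType) (p h : R) : 0 <= p <= 1 -> 0 <= h ->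
  1 - p + p * expR h <= expR (p * h + h ^+ 2 / 8).
Proof.
move=> /andP[p0 p1] h0.
pose D (x : R) := 1 - p + p * expR x.
have D_gt0 x : 0 < D x.
  have [p_eq0|pN0] := eqVneq p 0; first by rewrite /D p_eq0 mul0r subr0 addr0.
  have : 0 < p * expR x by rewrite mulr_gt0 ?expR_gt0// lt0r pN0.
  by rewrite /D; lra.
have D_0 : D 0 = 1 by rewrite /D expR0; lra.
have D0 x : D x != 0 by rewrite gt_eqF.
have dD x : is_derive x (1 : R) D (p * expR x).
  by apply: is_derive_eq; rewrite /GRing.scale/=; ring.
have dtau x : is_derive x (1 : R) (fun x => p + x / 4 + (1 - p) * (D x)^-1 - 1)
    (4^-1 - (1 - p) * (D x) ^- 2 * (p * expR x)).
  by apply: is_derive_eq; rewrite /GRing.scale/=; ring.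
have tau_ge0 x : 0 <= x -> 0 <= p + x / 4 + (1 - p) * (D x)^-1 - 1.
  move=> x0; have := le_is_derive_ge0 _ _ _ _ dtau _ x0.
  rewrite D_0 invr1 (_ : p + 0 / 4 + (1 - p) * 1 - 1 = 0); last by lra.
  apply=> y _; rewrite subr_ge0 mulrAC ler_pdivrMr ?exprn_gt0//.
  by rewrite /D; have := sqr_ge0 (1 - p - p * expR y); lra.
have dF x : is_derive x (1 : R)
    (fun x => - (expR (- (p * x + x ^+ 2 / 8)) * D x))
    (expR (- (p * x + x ^+ 2 / 8)) *
      (D x * (p + x / 4 + (1 - p) * (D x)^-1 - 1))).
  have dq : is_derive x (1 : R) (fun x => - (p * x + x ^+ 2 / 8)) (- (p + x / 4)).
    by apply: is_derive_eq; rewrite /GRing.scale/=; field.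
  have dE := is_derive1_comp (is_derive_expR _) dq.
  have dED := @is_deriveN _ _ _ _ _ _ _ (@is_deriveM _ _ _ _ _ _ _ _ dE (dD x)).
  apply: (is_derive_eq dED); rewrite /GRing.scale/=.
  have -> : p * expR x = D x - (1 - p) by rewrite /D; ring.
  by field.
have := le_is_derive_ge0 _ _ _ _ dF _ h0.
rewrite D_0 mulr0 expr0n/= mul0r addr0 oppr0 expR0 mul1r lerN2 expRN.
rewrite mulrC ler_pdivrMr ?expR_gt0// mul1r; apply=> x x0.
by rewrite !mulr_ge0 ?expR_ge0 ?tau_ge0// ltW.
Qed.

(** * Moments and tails of the hypergeometric distribution *)

Lemma card_draws_superset (T : finType) (J : {set T}) (s : nat) : (#|J| <= s)%N ->
  #|[set I : {set T} | #|I| == s & J \subset I]| = 'C(#|T| - #|J|, s - #|J|).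
Proof.
move=> Js; have -> : (#|T| - #|J| = #|~: J|)%N by rewrite [RHS]cardsCs setCK.
rewrite -cards_draws.
rewrite -[RHS](card_in_imset (f := fun A => J :|: A)).
  apply: eq_card => I; rewrite inE; apply/andP/imsetP => [[/eqP cI JI]|[A]].
    exists (I :\: J); last by rewrite -{1}(setID I J) (setIidPr JI).
    by rewrite inE setDE subsetIr/= -setDE cardsD (setIidPr JI) cI.
  rewrite inE => /andP[AJ /eqP cA] ->; split; last exact: subsetUl.
  rewrite cardsU cA (_ : J :&: A = set0) ?cards0 ?subn0 ?subnKC//.
  by apply/eqP; rewrite setI_eq0 disjoint_sym disjoints_subset.
move=> A A'; rewrite !inE => /andP[AJ _] /andP[AJ' _] e.
have KA (E : {set T}) : E \subset ~: J -> (J :|: E) :&: ~: J = E.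
  by move=> EJ; rewrite setIUl setICr set0U; apply/setIidPl.
by rewrite -(KA A)// e KA.
Qed.

(** Double counting of the pairs (J, I) with J a j-subset of B contained in I. Divided by the number
    of samples, this is the jth factorial moment over j!. *)
Lemma sum_bin_setI (T : finType) (B : {set T}) (s j : nat) : (j <= s)%N ->
  (\sum_(I : {set T} | #|I| == s) 'C(#|I :&: B|, j) =
   'C(#|B|, j) * 'C(#|T| - j, s - j))%N.
Proof.
move=> js; rewrite -cards_draws -sum1_card big_distrl/=.
transitivity (\sum_(I : {set T} | #|I| == s)
    \sum_(J : {set T} | (J \in [set A : {set T} | A \subset B & #|A| == j])
      && (J \subset I)) 1)%N.
  apply: eq_bigr => I _; rewrite -cards_draws -sum1_card.
  by apply: eq_bigl => J; rewrite !inE subsetI -andbA andbC.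
rewrite (exchange_big_dep (mem [set A : {set T} | A \subset B & #|A| == j]))/=; last first.
  by move=> I J _ /andP[].
apply: eq_bigr => J; rewrite mul1n inE => /andP[JB /eqP cJ].
rewrite -cJ -card_draws_superset ?cJ// -sum1_card; apply: eq_bigl => I.
by rewrite !inE JB eqxx.
Qed.

(** Factor by factor, (b - i) n <= (n - i) b: drawing without replacement hits a set j times in a
    row no more often than drawing with replacement. *)
Lemma ffact_exp_le (b n j : nat) : (b <= n)%N -> (b ^_ j * n ^ j <= n ^_ j * b ^ j)%N.
Proof.
move=> bn; elim: j => // j IH; rewrite !ffactnSr !expnSr mulnACA [leqRHS]mulnACA.
by apply: leq_mul => //; rewrite !mulnBl (mulnC b) leq_sub2l// leq_mul2l bn orbT.
Qed.

Lemma bin_exp_le (b n j : nat) : (b <= n)%N -> ('C(b, j) * n ^ j <= 'C(n, j) * b ^ j)%N.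
Proof.
move=> bn; rewrite -(leq_pmul2r (fact_gt0 j)) mulnAC bin_ffact mulnAC bin_ffact.
by rewrite ffact_exp_le.
Qed.

(** The summation limit [s] does not depend on [m], so that the sum over j can be exchanged with a
    sum over samples. *)
Lemma expr1D (R : comNzRingType) (y : R) (m s : nat) : (m <= s)%N ->
  (1 + y) ^+ m = \sum_(j < s.+1) 'C(m, j)%:R * y ^+ j.
Proof.
move=> ms; rewrite exprDn (big_ord_widen s.+1 (fun i => 1 ^+ (m - i) * y ^+ i *+ 'C(m, i)))//.
rewrite big_mkcond; apply: eq_bigr => i _; rewrite ltnS; case: leqP => mi.
  by rewrite expr1n mul1r mulr_natl.
by rewrite bin_small// mul0r.
Qed.

(* The factorial moments of |I :&: B| are at most those of sampling with
   replacement, and y >= 0 makes the generating function monotone in them. *)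
Lemma hypergeometric_mgf_le (R : realFieldType) (T : finType) (B : {set T}) (s : nat) (y : R) :
  0 <= y ->
  \sum_(I : {set T} | #|I| == s) (1 + y) ^+ #|I :&: B| <=
  'C(#|T|, s)%:R * (1 + #|B|%:R / #|T|%:R * y) ^+ s.
Proof.
move=> y0; set n := #|T|; set b := #|B|.
under eq_bigr => I /eqP cI.
  rewrite (@expr1D _ y _ s); last by rewrite -cI subset_leq_card// subsetIl.
  over.
rewrite exchange_big/= (@expr1D _ _ s s)// mulr_sumr; apply: ler_sum => j _.
have js : (j <= s)%N by rewrite -ltnS.
rewrite -mulr_suml -natr_sum sum_bin_setI// exprMn mulrA mulrA ler_wpM2r ?exprn_ge0//.
(* This is [sum_bin_setI] for the full set, counted in two ways. *)
have e : ('C(n, s) * 'C(s, j) = 'C(n, j) * 'C(n - j, s - j))%N.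
  have := sum_bin_setI _ [set: T] _ _ js; rewrite cardsT => <-.
  rewrite -card_draws -sum1_card big_distrl/=.
  by apply: eq_big => [I|I]; rewrite inE// => /eqP cI; rewrite setIT cI mul1n.
rewrite -!natrM e natrM natrM mulrAC ler_wpM2r// -/b.
have [n0|n_gt0] := posnP n.
  have -> : b = 0%N by apply/eqP; rewrite -leqn0 -n0 max_card.
  by case: (nat_of_ord j) => [|i]; rewrite ?bin0 ?expr0 ?mulr1// bin0n
    mulr_ge0// exprn_ge0// mul0r.
rewrite expr_div_n mulrA ler_pdivlMr ?exprn_gt0 ?ltr0n// -!natrX -!natrM ler_nat.
exact/bin_exp_le/max_card.
Qed.

(** Chernoff's method: Markov's inequality for exp(h |I :&: B|), then the generating function bound
    at y = e^h - 1, then Hoeffding's lemma. Probabilities are kept as cardinalities. *)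
Lemma hypergeometric_upper_tail (R : realType) (T : finType) (B : {set T}) (s : nat) (g : R) :
  (0 < s)%N -> 0 <= g ->
  #|[set I : {set T} | (#|I| == s) &&
      (#|B|%:R * s%:R / #|T|%:R + g <= #|I :&: B|%:R)]|%:R
  <= 'C(#|T|, s)%:R * expR (- (2 * g ^+ 2 / s%:R)).
Proof.
move=> s_gt0 g0; set n := #|T|; set b := #|B|; set E := [set I | _].
have sR : 0 < s%:R :> R by rewrite ltr0n.
(* This h minimizes s h^2 / 8 - h g, with minimum -2 g^2 / s. *)
pose h : R := 4 * g / s%:R; pose p : R := b%:R / n%:R.
have h0 : 0 <= h by rewrite divr_ge0 ?mulr_ge0// ltW.
have p01 : 0 <= p <= 1.
  rewrite divr_ge0//=; have [n0|n_gt0] := posnP n; first by rewrite /p n0 invr0 mulr0.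
  by rewrite ler_pdivrMr ?ltr0n// mul1r ler_nat max_card.
have e1 : 0 <= expR h - 1 by rewrite subr_ge0 -expR0 ler_expR.
have markov : #|E|%:R * expR (h * (b%:R * s%:R / n%:R + g)) <=
    \sum_(I : {set T} | #|I| == s) (1 + (expR h - 1)) ^+ #|I :&: B|.
  rewrite -sum1_card natr_sum mulr_suml [leRHS](bigID (mem E))/= -[leLHS]addr0; apply: lerD.
    rewrite [leRHS](eq_bigl (mem E)); last first.
      by move=> I; rewrite !inE; case: eqP.
    apply: ler_sum => I; rewrite inE => /andP[_ IB].
    by rewrite mul1r (addrC 1) subrK -expRM_natr ler_expR ler_wpM2l.
  by apply: sumr_ge0 => I _; rewrite exprn_ge0// addr_ge0.
have := le_trans markov (hypergeometric_mgf_le _ _ B s _ e1).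
rewrite -/n -/b -/p -ler_pdivlMr ?expR_gt0// => /le_trans; apply.
rewrite -[leLHS]mulrA ler_wpM2l// ler_pdivrMr ?expR_gt0// -expRD.
have -> : 1 + p * (expR h - 1) = 1 - p + p * expR h by ring.
have pe_ge0 : 0 <= 1 - p + p * expR h.
  by move: p01 => /andP[pge0 ple1]; rewrite addr_ge0 ?subr_ge0// mulr_ge0 ?expR_ge0.
apply: (@le_trans _ _ (expR (p * h + h ^+ 2 / 8) ^+ s)).
  by rewrite lerXn2r ?nnegrE ?expR_ge0// hoeffding_lemma.
rewrite -expRM_natr ler_expR le_eqVlt; apply/orP; left; apply/eqP.
have -> : b%:R * s%:R / n%:R = p * s%:R by rewrite mulrAC.
by clearbody p; rewrite /h; field; rewrite gt_eqF.
Qed.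

(** A sample poor in [A] is rich in the complement of [A], so the upper tail applies there. *)
Lemma hypergeometric_lower_tail (R : realType) (T : finType) (A : {set T}) (s : nat) (g : R) :
  (0 < s)%N -> 0 <= g ->
  #|[set I : {set T} | (#|I| == s) &&
      (#|I :&: A|%:R <= #|A|%:R * s%:R / #|T|%:R - g)]|%:R
  <= 'C(#|T|, s)%:R * expR (- (2 * g ^+ 2 / s%:R)).
Proof.
move=> s_gt0 g0; apply: le_trans (hypergeometric_upper_tail _ _ (~: A) _ _ s_gt0 g0).
rewrite ler_nat; apply/subset_leq_card/fintype.subsetP => I; rewrite !inE => /andP[/eqP cI IA].
rewrite cI eqxx/=.
have T_gt0 : (0 < #|T|)%N.
  by apply: leq_trans s_gt0 _; rewrite -cI max_card.
have -> : #|~: A|%:R = #|T|%:R - #|A|%:R :> R.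
  by rewrite -(cardsC A) natrD addrC addKr.
have -> : #|I :&: ~: A|%:R = s%:R - #|I :&: A|%:R :> R.
  by rewrite -setDE -cI -(cardsID A I) natrD addrC addKr.
rewrite mulrBl mulrBl mulrAC mulfV ?pnatr_eq0 -?lt0n// mul1r.
by lra.
Qed.

(* The smallest member of the chain with at least m elements witnesses the
   deviation for all the larger ones. *)
Lemma hypergeometric_chain_tail (R : realType) (T J : finType) (A : J -> {set T})
    (s : nat) (m g : R) :
  (forall i j, (A i \subset A j) || (A j \subset A i)) ->
  (0 < s)%N -> 0 <= g ->
  exists bad : {set {set T}},
    #|bad|%:R <= 'C(#|T|, s)%:R * expR (- (2 * g ^+ 2 / s%:R)) /\
    forall (I : {set T}) (j : J), #|I| = s -> m <= #|A j|%:R ->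
      #|I :&: A j|%:R <= m * s%:R / #|T|%:R - g -> I \in bad.
Proof.
move=> chain s_gt0 g0.
have [j0 mj0|none] := pickP (fun j => m <= #|A j|%:R); last first.
  exists set0; rewrite cards0; split; first by rewrite mulr_ge0 ?expR_ge0.
  by move=> I j _; rewrite none.
case: (@arg_minnP _ j0 (fun j => m <= #|A j|%:R) (fun j => #|A j|) mj0) => j1 mj1 minj1.
exists [set I : {set T} | (#|I| == s) &&
      (#|I :&: A j1|%:R <= #|A j1|%:R * s%:R / #|T|%:R - g)].
split; first exact: hypergeometric_lower_tail.
move=> I j cI mj Ij; rewrite inE cI eqxx/=.
(* Comparable sets are nested according to their cardinalities. *)
have A1j : A j1 \subset A j.
  have [//|Aj1] := orP (chain j1 j).
  have/eqP -> : A j == A j1 by rewrite eqEcard Aj1 minj1.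
  exact: subxx.
apply: (@le_trans _ _ (#|I :&: A j|%:R)).
  by rewrite ler_nat subset_leq_card// setIS.
by apply: le_trans Ij _; rewrite lerD2r ler_wpM2r ?invr_ge0// ler_wpM2r.
Qed.

(** * Order statistics of a sequence with repetitions *)

Section SortedCount.
Context {d : Order.disp_t} {T : orderType d}.
Implicit Types (x : T) (S : seq T).

Lemma le_nth_sort (x0 : T) S i j : (i <= j < size S)%N ->
  (nth x0 (sort <=%O S) i <= nth x0 (sort <=%O S) j)%O.
Proof.
move=> /andP[ij js]; apply: (sorted_leq_nth le_trans le_refl) => //.
- by rewrite inE size_sort (leq_ltn_trans ij).
- by rewrite inE size_sort.
Qed.

Lemma count_lt_nth_sort (x0 : T) S i : (i < size S)%N ->
  (count (fun x => (x < nth x0 (sort <=%O S) i)%O) S <= i)%N.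
Proof.
move=> iS; set Y := sort _ S; have pY : perm_eq Y S by rewrite perm_sort.
rewrite -(permP pY).
rewrite -{2}(cat_take_drop i Y) count_cat (_ : count _ (drop i Y) = 0%N).
  by rewrite addn0 (leq_trans (count_size _ _))// size_take; case: ltnP.
apply/eqP; rewrite -leqn0 leqNgt -has_count -all_predC; apply/(all_nthP x0) => j.
rewrite size_drop size_sort => jS; rewrite nth_drop /= -leNgt le_nth_sort// leq_addr/=.
by lia.
Qed.

Lemma count_gt_nth_sort (x0 : T) S i : (i < size S)%N ->
  (count (fun x => (nth x0 (sort <=%O S) i < x)%O) S <= size S - i.+1)%N.
Proof.
move=> iS; set Y := sort _ S; have pY : perm_eq Y S by rewrite perm_sort.
rewrite -(permP pY).
rewrite -{2}(cat_take_drop i.+1 Y) count_cat (_ : count _ (take _ Y) = 0%N).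
  by rewrite add0n (leq_trans (count_size _ _))// size_drop size_sort.
apply/eqP; rewrite -leqn0 leqNgt -has_count -all_predC; apply/(all_nthP x0) => j.
rewrite size_takel ?size_sort// => jS; rewrite nth_take//= -leNgt le_nth_sort//.
by rewrite -ltnS jS.
Qed.

End SortedCount.

(** * Counting entries through sets of positions *)

Lemma count_enum_set (T : finType) (A : {set T}) (p : pred T) :
  count p (enum A) = #|A :&: [set i | p i]|.
Proof.
by rewrite -sum1_count big_enum_cond -sum1_card; apply: eq_bigl => i; rewrite !inE.
Qed.

Lemma count_map_nth (T : Type) (x0 : T) (n : nat) (X : seq T) (p : pred T) (A : {set 'I_n}) :
  count p [seq nth x0 X (nat_of_ord i) | i <- enum A] =
  #|A :&: [set i : 'I_n | p (nth x0 X i)]|.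
Proof. by rewrite count_map count_enum_set. Qed.

Lemma map_nth_setT (T : Type) (x0 : T) (n : nat) (X : seq T) : size X = n ->
  [seq nth x0 X (nat_of_ord i) | i <- enum [set: 'I_n]] = X.
Proof.
move=> <-; apply: (@eq_from_nth _ x0) => [|i]; rewrite size_map -cardE cardsT card_ord// => iX.
rewrite (nth_map (Ordinal iX)) -?cardE ?cardsT ?card_ord//.
by rewrite enum_setT -enumT nth_enum_ord.
Qed.

Lemma count_nth_card (T : Type) (x0 : T) (n : nat) (X : seq T) (p : pred T) : size X = n ->
  count p X = #|[set i : 'I_n | p (nth x0 X i)]|.
Proof. by move=> nX; rewrite -{1}(map_nth_setT _ x0 _ _ nX) count_map_nth setTI. Qed.

(** * Deterministic cost bounds and the failure sets *)

Section SelectCount.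
Context {R : realType} {d : Order.disp_t} {T : orderType d}.
Variables (gammaP : R) (cost2 : seq T -> nat -> nat -> nat) (costR : seq T -> nat -> nat).
Hypothesis gamma_ge0 : 0 <= gammaP.
Hypothesis hcost2 : forall (S : seq T) (a b : nat),
  (1 <= a <= size S)%N -> (1 <= b <= size S)%N ->
  (cost2 S a b)%:R <= 2 * gammaP * (size S)%:R.
Hypothesis hcostR : forall (Y : seq T) (i : nat), (1 <= i <= size Y)%N ->
  (costR Y i)%:R <= gammaP * (size Y)%:R.

(** If u < v, every x satisfies x < v or u < x, and both exactly on M, so inclusion-exclusion gives
    equality with the sum. If u = v, M is empty. Control of both pivots thus bounds |M|. *)
Lemma partition_count_le (u v : T) (X : seq T) : (u <= v)%O ->
  (size X + count (fun x => (u < x)%O && (x < v)%O) X <=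
   maxn (size X) (count (fun x => (x < v)%O) X + count (fun x => (u < x)%O) X))%N.
Proof.
rewrite le_eqVlt => /predU1P[->|uv].
  rewrite (eq_count (a2 := pred0)) ?count_pred0 ?addn0 ?leq_maxl// => x /=.
  by apply/negbTE/negP => /andP[vx /(lt_trans vx)]; rewrite ltxx.
rewrite -count_predUI leq_max; apply/orP; right.
rewrite [count (predU _ _) X](_ : _ = size X); last first.
  rewrite -count_predT; apply: eq_count => x /=.
  by case: (ltP x v) => //= vx; rewrite (lt_le_trans uv vx).
by rewrite leq_add2l sub_count// => x /=; rewrite andbC.
Qed.

(* Delta stands for the rank fluctuation g n / s; ea, eb, ec, ed mark the four
   failures: x_k* < u, u too small, v < x_k*, v too large. *)
Lemma step4_cost_le (X : seq T) (k : nat) (u v : T) (Delta : R) (ea eb ec ed : bool) :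
  let n := size X in
  let nL := count (fun x => (x < u)%O) X in
  let nU := count (fun x => x == u) X in
  let nM := count (fun x => (u < x)%O && (x < v)%O) X in
  let nR := count (fun x => (v < x)%O) X in
  (u <= v)%O -> (1 <= k <= n)%N -> 0 <= Delta ->
  (~~ ea -> (k <= nL)%N -> k%:R <= Delta) ->
  (~~ eb -> (count (fun x => (u < x)%O) X)%:R <= n%:R - k%:R + 2 * Delta) ->
  (~~ ec -> (n - k < nR)%N -> n%:R - k%:R <= Delta) ->
  (~~ ed -> (count (fun x => (x < v)%O) X)%:R <= k%:R + 2 * Delta) ->
  (if (nL < k <= nL + nU)%N || (nL + nU + nM < k <= n - nR)%N then 0
   else if (k <= nL)%N then costR (filter (fun x => (x < u)%O) X) k
   else if (n - nR < k)%N then costR (filter (fun x => (v < x)%O) X) (k - (n - nR))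
   else costR (filter (fun x => (u < x)%O && (x < v)%O) X) (k - (nL + nU)))%:R
  <= gammaP * (4 * Delta + (ea%:R + eb%:R + ec%:R + ed%:R) * n%:R).
Proof.
(* When k falls into none of L, U, {x = v} and R, its rank relative to M is valid for [costR]. *)
have rankM (nL nU nM r k' : nat) : ~~ (nL < k' <= nL + nU)%N ->
    ~~ (nL + nU + nM < k' <= r)%N -> (nL < k')%N -> (k' <= r)%N ->
    (1 <= k' - (nL + nU) <= nM)%N by lia.
have swap (a b c : nat) : (c <= a -> b <= a -> a - c < b -> a - b < c)%N by lia.
move=> n nL nU nM nR uv /andP[k1 kn] D0 ha hb hc hd.
have nLn : (nL <= n)%N := count_size _ _.
have nRn : (nR <= n)%N := count_size _ _.
have nMn : (nM <= n)%N := count_size _ _.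
have e0 (b : bool) : 0 <= b%:R :> R by [].
(* A single failure already pays for n elements, so only the case without failure has to be
   estimated. *)
have reduce (m : nat) : (m <= n)%N ->
    (~~ ea -> ~~ eb -> ~~ ec -> ~~ ed -> m%:R <= 4 * Delta) ->
    gammaP * m%:R <= gammaP * (4 * Delta + (ea%:R + eb%:R + ec%:R + ed%:R) * n%:R).
  move=> mn hm; apply: ler_wpM2l => //.
  have mnR : m%:R <= n%:R :> R by rewrite ler_nat.
  have [/and4P[a b c e]|] := boolP [&& ~~ ea, ~~ eb, ~~ ec & ~~ ed].
    by apply: (le_trans (hm a b c e)); rewrite lerDl mulr_ge0// !addr_ge0.
  rewrite -!negb_or negbK => oneb.
  have one : (1 : R) <= ea%:R + eb%:R + ec%:R + ed%:R.
    by rewrite -!natrD ler1n; case: ea eb ec ed oneb {ha hb hc hd hm} => [] [] [] [].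
  apply: (le_trans mnR); apply: (@le_trans _ _ ((ea%:R + eb%:R + ec%:R + ed%:R) * n%:R)).
    by rewrite ler_peMl.
  by rewrite lerDr mulr_ge0.
have kR : k%:R <= n%:R :> R by rewrite ler_nat.
case: ifPn => [_|].
  by rewrite mulr_ge0// addr_ge0 ?mulr_ge0// !addr_ge0.
rewrite negb_or => /andP[notU notV]; case: ifPn => [kL|]; last first.
  rewrite -ltnNge => Lk; case: ifPn => [kR'|].
    apply: (le_trans (hcostR _ _ _)); first by rewrite size_filter -/nR; lia.
    rewrite size_filter; apply: reduce => // na nb nc nd.
    (* R lies in {x > u}, so |R| <= n - k + 2 Delta <= 3 Delta. *)
    have RRu : (nR <= count (fun x => (u < x)%O) X)%N.
      by apply: sub_count => x; apply: le_lt_trans.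
    have := hb nb; have : (nR%:R : R) <= (count (fun x => (u < x)%O) X)%:R by rewrite ler_nat.
    have := hc nc (swap _ _ _ nRn kn kR').
    by rewrite -/nR; lra.
  rewrite -leqNgt => kR'.
  apply: (le_trans (hcostR _ _ _)); first by rewrite size_filter (rankM _ _ _ _ _ notU notV).
  rewrite size_filter; apply: reduce => // na nb nc nd.
  (* Either M is empty or n + |M| <= (k + 2 Delta) + (n - k + 2 Delta); this is the source of the 4
     Delta. *)
  have := partition_count_le _ _ X uv; rewrite -/n -/nM => h.
  have [M0|MLR] : (nM = 0 \/
      n + nM <= count (fun x => (x < v)%O) X + count (fun x => (u < x)%O) X)%N.
  - move: h; rewrite leq_max -{2}[n]addn0 leq_add2l leqn0 => /orP[/eqP|]; by [left|right].
  - by rewrite -/nM M0 mulr_ge0.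
  move: MLR; rewrite -(ler_nat R) !natrD -/nM; have := hb nb; have := hd nd; lra.
apply: (le_trans (hcostR _ _ _)); first by rewrite size_filter k1.
rewrite size_filter; apply: reduce => // na nb nc nd.
(* L lies in {x < v}, so |L| <= k + 2 Delta <= 3 Delta. *)
have LLv : (nL <= count (fun x => (x < v)%O) X)%N.
  by apply: sub_count => x xu; apply: lt_le_trans uv.
move: LLv; rewrite -(ler_nat R) -/nL; have := hd nd; have := ha na kL; lra.
Qed.

(** The test k < n/2 picks the order of comparisons so that the second ones number at most k + 2
    Delta or n - k + 2 Delta, whichever corresponds to min(k, n - k). Only a pivot v too large or u
    too small can break this. *)
Lemma step3_cost_le (X NS : seq T) (k s : nat) (u v : T) (Delta : R) (eb ed : bool) :
  let n := size X in
  (forall p, count p NS <= count p X)%N ->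
  (1 <= k <= n)%N -> (s <= n)%N -> 0 <= Delta ->
  (~~ eb -> (count (fun x => (u < x)%O) X)%:R <= n%:R - k%:R + 2 * Delta) ->
  (~~ ed -> (count (fun x => (x < v)%O) X)%:R <= k%:R + 2 * Delta) ->
  (if u == v then n - s
   else if 2 * k < n then (n - s) + count (fun x => (x < v)%O) NS
   else (n - s) + count (fun x => (u < x)%O) NS)%N%:R
  <= n%:R - s%:R + (minn k (n - k))%:R + 2 * Delta + (eb%:R + ed%:R) * n%:R.
Proof.
move=> n NSX /andP[k1 kn] sn D0 hb hd.
have bound (p : pred T) (m : R) (e1 e2 : bool) : 0 <= m ->
    (~~ e1 -> (count p X)%:R <= m + 2 * Delta) ->
    (count p NS)%:R <= m + 2 * Delta + (e1%:R + e2%:R) * n%:R.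
  move=> m0 h; apply: (@le_trans _ _ (count p X)%:R); first by rewrite ler_nat.
  have cn : (count p X)%:R <= n%:R :> R by rewrite ler_nat count_size.
  case: e1 h => h; last first.
    by apply: le_trans (h isT) _; rewrite lerDl mulr_ge0// addr_ge0.
  apply: (le_trans cn); rewrite -[leLHS]add0r lerD ?addr_ge0 ?mulr_ge0//.
  by rewrite ler_peMl// lerDl.
case: ifPn => [_|_].
  by rewrite natrB// -!addrA lerD2l lerDl !addr_ge0// ?mulr_ge0// addr_ge0.
have mnE : (minn k (n - k))%:R = if (2 * k < n)%N then k%:R else n%:R - k%:R :> R.
  by rewrite -natrB//; case: ltnP => ?; congr (_%:R); lia.
rewrite mnE; case: ifPn => h; rewrite natrD natrB// -2!(addrA (_ - s%:R)) lerD2l.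
  by rewrite (addrC eb%:R); apply: bound.
by apply: bound => //; rewrite subr_ge0 ler_nat.
Qed.
(** The random pivots are entries of X, hence given by positions [ju] and [jv]; the sets below and
    above them then belong to chains indexed by the finite type of positions. The failure flags stay
    arbitrary, to be instantiated by membership in failure sets. *)
Lemma select_count_pivots (x0 : T) (X' : seq T) (n k s iu iv : nat) (I : {set 'I_n}) (Delta : R) :
  let X := x0 :: X' in
  let lt j := [set i : 'I_n | (nth x0 X i < nth x0 X j)%O] in
  let gt j := [set i : 'I_n | (nth x0 X j < nth x0 X i)%O] in
  size X = n -> #|I| = s -> (1 <= iu <= iv)%N -> (iv <= s)%N -> (1 <= k <= n)%N ->
  0 <= Delta ->
  exists ju jv : 'I_n,
    [/\ #|I :&: lt ju| <= iu.-1, #|I :&: gt ju| <= s - iu,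
        #|I :&: lt jv| <= iv.-1 & #|I :&: gt jv| <= s - iv]%N /\
    forall ea eb ec ed : bool,
    (~~ ea -> (k <= #|lt ju|)%N -> k%:R <= Delta) ->
    (~~ eb -> #|gt ju|%:R <= n%:R - k%:R + 2 * Delta) ->
    (~~ ec -> (n - k < #|gt jv|)%N -> n%:R - k%:R <= Delta) ->
    (~~ ed -> #|lt jv|%:R <= k%:R + 2 * Delta) ->
    (select_count cost2 costR n k iu iv X I)%:R <=
      2 * gammaP * s%:R
      + (n%:R - s%:R + (minn k (n - k))%:R + 2 * Delta + (eb%:R + ed%:R) * n%:R)
      + gammaP * (4 * Delta + (ea%:R + eb%:R + ec%:R + ed%:R) * n%:R).
Proof.
move=> X lt gt nX cI /andP[iu1 iuv] ivs kn D0.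
set S := [seq nth x0 X (nat_of_ord i) | i <- enum I].
have sS : size S = s by rewrite size_map -cardE.
pose Ys := sort <=%O S; pose u := nth x0 Ys iu.-1; pose v := nth x0 Ys iv.-1.
have iuS : (iu.-1 < size S)%N by rewrite sS prednK// (leq_trans iuv).
have ivS : (iv.-1 < size S)%N by rewrite sS prednK// (leq_trans iu1).
have inX i : (i < size S)%N -> exists j : 'I_n, nth x0 Ys i = nth x0 X j.
  move=> iS; have : nth x0 Ys i \in S by rewrite -(mem_sort <=%O) mem_nth// size_sort.
  by move=> /mapP[j _ ->]; exists j.
have [ju uE] := inX _ iuS; have [jv vE] := inX _ ivS; exists ju, jv.
have cX (p : pred T) := count_nth_card _ x0 _ _ p nX.
have ltE j : #|lt j| = count (fun x => (x < nth x0 X j)%O) X by rewrite cX.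
have gtE j : #|gt j| = count (fun x => (nth x0 X j < x)%O) X by rewrite cX.
split.
  have ltS j : #|I :&: lt j| = count (fun x => (x < nth x0 X j)%O) S by rewrite count_map_nth.
  have gtS j : #|I :&: gt j| = count (fun x => (nth x0 X j < x)%O) S by rewrite count_map_nth.
  rewrite !ltS !gtS -uE -vE; split; rewrite ?count_lt_nth_sort//.
    by have := count_gt_nth_sort x0 _ _ iuS; rewrite prednK// sS.
  by have := count_gt_nth_sort x0 _ _ ivS; rewrite prednK ?(leq_trans iu1)// sS.
move=> ea eb ec ed; rewrite !ltE !gtE -uE -vE -/u -/v => ha hb hc hd.
have uv : (u <= v)%O.
  by rewrite /u /v le_nth_sort// ivS andbT -!subn1 leq_sub2r.
rewrite /select_count {1}/X; lazy match zeta; rewrite -/S -/Ys -/u -/v.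
rewrite sS natrD natrD.
apply: lerD; first apply: lerD.
- by rewrite -sS hcost2// sS ?iu1 ?(leq_trans iu1)// (leq_trans iuv).
- have sn : (s <= n)%N by rewrite -cI -[leqRHS]card_ord max_card.
  set NS := [seq _ | i <- enum (~: I)].
  have NSX p : (count p NS <= count p X)%N.
    by rewrite count_map_nth cX; exact/subset_leq_card/subsetIr.
  clearbody NS; move: sn kn hb hd; rewrite -nX => sn kn hb hd.
  exact: step3_cost_le.
- move: kn ha hb hc hd; rewrite -nX => kn ha hb hc hd; exact: step4_cost_le.
Qed.

(** The chain tail bound is applied to the sets {x < t} with thresholds k and k + 2 Delta, and to {x
    > t} with n - k and n - k + 2 Delta. Of the rounding of the sample indices, only the stated
    inequalities matter. *)
Lemma select_count_failure_sets (X : seq T) (n k s iu iv : nat) (g : R) :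
  let a := k%:R * s%:R / n%:R in
  let Delta := g * n%:R / s%:R in
  size X = n -> (1 <= iu <= iv)%N -> (iv <= s)%N -> (1 <= k <= n)%N -> 0 <= g ->
  a - g <= iu%:R -> (0 < a - g -> iu%:R - 1 <= a - g) ->
  iv%:R - 1 <= a + g -> (a + g <= s%:R -> a + g <= iv%:R) ->
  exists ba bb bc bd : {set {set 'I_n}},
    (forall b, b \in [:: ba; bb; bc; bd] ->
       #|b|%:R <= 'C(n, s)%:R * expR (- (2 * g ^+ 2 / s%:R))) /\
    forall I : {set 'I_n}, #|I| = s ->
    (select_count cost2 costR n k iu iv X I)%:R <=
      2 * gammaP * s%:R
      + (n%:R - s%:R + (minn k (n - k))%:R + 2 * Delta
         + ((I \in bb)%:R + (I \in bd)%:R) * n%:R)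
      + gammaP * (4 * Delta + ((I \in ba)%:R + (I \in bb)%:R
                               + (I \in bc)%:R + (I \in bd)%:R) * n%:R).
Proof.
move=> a Delta nX iuv ivs kn g0 iu_ge iu_le iv_le iv_ge.
case: X nX => [n0|x0 X' nX]; first by move: kn;
  rewrite -n0 leqn0 => /andP[/lt0n_neq0/negbTE ->].
set X := x0 :: X'.
have [/andP[iu1 iuv'] /andP[k1 kn']] := (iuv, kn).
have s_gt0 : (0 < s)%N by rewrite (leq_trans _ ivs)// (leq_trans iu1).
have n_gt0 : (0 < n)%N by rewrite (leq_trans k1).
have sR : 0 < s%:R :> R by rewrite ltr0n.
have nR : 0 < n%:R :> R by rewrite ltr0n.
have D0 : 0 <= Delta by rewrite divr_ge0 ?mulr_ge0.
(* Delta ranks in the input correspond to g expected sample elements. *)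
have DE : Delta * s%:R / n%:R = g by rewrite /Delta; field; rewrite !gt_eqF.
pose lt (j : 'I_n) := [set i : 'I_n | (nth x0 X i < nth x0 X j)%O].
pose gt (j : 'I_n) := [set i : 'I_n | (nth x0 X j < nth x0 X i)%O].
have lt_chain i j : (lt i \subset lt j) || (lt j \subset lt i).
  by case: (leP (nth x0 X i) (nth x0 X j)) => [|/ltW] ij; apply/orP; [left|right];
    apply/fintype.subsetP => l; rewrite !inE => /lt_le_trans; apply.
have gt_chain i j : (gt i \subset gt j) || (gt j \subset gt i).
  by case: (leP (nth x0 X i) (nth x0 X j)) => [|/ltW] ij; apply/orP; [right|left];
    apply/fintype.subsetP => l; rewrite !inE; apply: le_lt_trans.
have [ba [ba_le baP]] :=
  hypergeometric_chain_tail R _ _ lt s k%:R g lt_chain s_gt0 g0.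
have [bb [bb_le bbP]] :=
  hypergeometric_chain_tail R _ _ gt s (n%:R - k%:R + 2 * Delta) g gt_chain s_gt0 g0.
have [bc [bc_le bcP]] :=
  hypergeometric_chain_tail R _ _ gt s (n%:R - k%:R) g gt_chain s_gt0 g0.
have [bd [bd_le bdP]] :=
  hypergeometric_chain_tail R _ _ lt s (k%:R + 2 * Delta) g lt_chain s_gt0 g0.
rewrite card_ord in ba_le baP bb_le bbP bc_le bcP bd_le bdP.
exists ba, bb, bc, bd; split.
  by move=> b; rewrite !inE => /or4P[] /eqP ->.
move=> I cI.
have [ju [jv [[ltu gtu ltv gtv] bound]]] :=
  select_count_pivots x0 X' n k s iu iv I Delta nX cI iuv ivs kn D0.
have {}ltu : #|I :&: lt ju|%:R <= iu%:R - 1 :> R.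
  by rewrite lerBrDr natr1 ler_nat -(prednK iu1) ltnS.
have {}ltv : #|I :&: lt jv|%:R <= iv%:R - 1 :> R.
  by rewrite lerBrDr natr1 ler_nat -(prednK (leq_trans iu1 iuv')) ltnS.
have {}gtu : #|I :&: gt ju|%:R <= s%:R - iu%:R :> R.
  by rewrite -natrB ?(leq_trans iuv')// ler_nat.
have {}gtv : #|I :&: gt jv|%:R <= s%:R - iv%:R :> R.
  by rewrite -natrB ?(leq_trans iuv')// ler_nat.
have nkE : (n%:R - k%:R) * s%:R / n%:R = s%:R - a.
  by rewrite /a; field; rewrite gt_eqF.
(* The surplus 2 Delta is worth 2 g sample elements: one g is the deviation, the other offsets the
   shift of the pivot index by g. *)
have tail2 m : (m + 2 * Delta) * s%:R / n%:R - g = m * s%:R / n%:R + g.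
  by rewrite -[in LHS]DE -[in RHS]DE; field; rewrite gt_eqF.
apply: bound; rewrite -/(lt _) -/(gt _).
(* If k > Delta then a - g > 0, so the lower clamp of [iu] at 1 is inactive. *)
- move=> Iba kL; rewrite leNgt; apply: contra Iba => Dk; apply: (baP _ ju) => //.
    by rewrite ler_nat.
  rewrite -/a (le_trans ltu)// iu_le// subr_gt0 -DE /a ltr_pM2r ?invr_gt0//.
  by rewrite ltr_pM2r.
- rewrite leNgt; apply: contra => /ltW Dk; apply: (bbP _ ju) => //.
  rewrite tail2 nkE; lra.
(* Symmetrically, n - k > Delta gives a + g < s, so the upper clamp of [iv] at s is inactive. *)
- move=> Ibc kR; rewrite leNgt; apply: contra Ibc => Dk; apply: (bcP _ jv) => //.
    by rewrite -natrB// ler_nat ltnW.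
  have gs : g < s%:R - a by rewrite -nkE -DE ltr_pM2r ?invr_gt0// ltr_pM2r.
  have : a + g <= s%:R by lra.
  by move=> /iv_ge; rewrite nkE; lra.
- rewrite leNgt; apply: contra => /ltW Dk; apply: (bdP _ jv) => //.
  rewrite tail2 -/a; lra.
Qed.

End SelectCount.

(** * Rounding and clamping of the sample indices *)

Section SampleIndices.
Context {R : realType}.
Variables (n k s : nat) (g : R).
Hypotheses (kn : (1 <= k <= n)%N) (s_gt0 : (0 < s)%N) (g_ge0 : 0 <= g).
Let a : R := k%:R * s%:R / n%:R.

Let n_gt0 : 0 < n%:R :> R.
Proof. by have /andP[k1 /(leq_trans k1)] := kn; rewrite ltr0n. Qed.

Let a_gt0 : 0 < a.
Proof. by have /andP[k1 _] := kn; rewrite /a divr_gt0// mulr_gt0 ?ltr0n. Qed.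

Let a_le : a <= s%:R.
Proof.
have /andP[_ kn'] := kn.
by rewrite /a ler_pdivrMr// mulrC ler_wpM2l// ler_nat.
Qed.

Lemma idx_uE : (idx_u n k s g)%:Z = Num.max (Num.ceil (a - g)) 1.
Proof. by rewrite /idx_u gez0_abs// le_max ler01 orbT. Qed.

Lemma idx_vE : (idx_v n k s g)%:Z = Num.min (Num.ceil (a + g)) s%:Z.
Proof.
rewrite /idx_v -/a gez0_abs// le_min ceil_ge0 andbT.
by rewrite (lt_le_trans (ltrN10 R))// addr_ge0// ltW.
Qed.

(** Since 0 < a <= s and g >= 0, neither clamp conflicts with the other index: ceil(a + g) >= 1 and
    ceil(a - g) <= s. *)
Lemma idx_bounds : (1 <= idx_u n k s g <= idx_v n k s g)%N /\ (idx_v n k s g <= s)%N.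
Proof.
rewrite -!lez_nat idx_uE idx_vE ge_min lexx orbT; split => //.
rewrite le_max lexx orbT/= le_min !ge_max le_ceil; last first.
  by rewrite lerD2l (le_trans _ g_ge0)// oppr_le0.
have c1 : (1 <= Num.ceil (a + g))%R by rewrite -gtz0_ge1 ceil_gt0 ltr_wpDr.
by rewrite c1/= ceil_le_int lez_nat s_gt0 andbT lerBlDr (le_trans a_le)// lerDl.
Qed.

Lemma idx_u_ge : a - g <= (idx_u n k s g)%:R.
Proof.
rewrite pmulrn idx_uE (le_trans (ceil_ge _))// ler_int le_max lexx//.
Qed.

Lemma idx_u_le : 0 < a - g -> (idx_u n k s g)%:R - 1 <= a - g.
Proof.
move=> ag; rewrite pmulrn idx_uE max_l -?gtz0_ge1 ?ceil_gt0//.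
by have := ceilB1_lt (a - g); rewrite intrB => /ltW.
Qed.

Lemma idx_v_le : (idx_v n k s g)%:R - 1 <= a + g.
Proof.
rewrite pmulrn idx_vE; apply: le_trans (ltW (ceilB1_lt (a + g))).
by rewrite intrB lerD2r ler_int ge_min lexx.
Qed.

Lemma idx_v_ge : a + g <= s%:R -> a + g <= (idx_v n k s g)%:R.
Proof.
by move=> ags; rewrite pmulrn idx_vE min_l ?ceil_ge// ceil_le_int.
Qed.

End SampleIndices.

(** * Estimates for f(n) and the gap *)

Section GrowthRate.
Context {R : realType}.

(** From e^(-1/6) >= 5/6 one gets e <= (6/5)^6 < 3. This yields ln n >= 1 for n >= 3. *)
Lemma expR1_le3 : expR 1 <= 3 :> R.
Proof.
have h : (5 / 6 : R) <= expR (- (1 / 6)) by apply: le_trans (expR_ge1Dx _); lra.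
have h6 : expR (1 / 6) <= 6 / 5 :> R.
  rewrite -[X in expR X]opprK expRN -[leRHS]invrK lef_pV2 ?posrE ?expR_gt0 ?invr_gt0//.
    by rewrite invf_div.
  by rewrite divr_gt0.
have -> : (1 : R) = 6%:R * (1 / 6) by lra.
rewrite expRM_natl (le_trans (lerXn2r 6 _ _ h6)) ?nnegrE ?expR_ge0 ?divr_ge0//.
by rewrite !exprS expr0; lra.
Qed.

Lemma ln_ge1 (n : nat) : (3 <= n)%N -> 1 <= ln n%:R :> R.
Proof.
move=> n3; rewrite -[leLHS]expRK ler_ln ?posrE ?expR_gt0 ?ltr0n ?(leq_trans _ n3)//.
by rewrite (le_trans expR1_le3)// ler_nat.
Qed.

Variable n : nat.
Hypothesis n3 : (3 <= n)%N.
Let f : R := fN n.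
Let n_gt0 : 0 < n%:R :> R. Proof. by rewrite ltr0n (leq_trans _ n3). Qed.
Let ln_gt0 : 0 < ln n%:R :> R. Proof. exact: lt_le_trans (ln_ge1 n n3). Qed.

Lemma fN_gt0 : 0 < f.
Proof. by rewrite /f /fN mulr_gt0// powR_gt0. Qed.

Lemma fN_cube : f ^+ 3 = n%:R ^+ 2 * ln n%:R.
Proof.
rewrite /f /fN exprMn -!powR_mulrn ?powR_ge0 ?(ltW n_gt0)// -!powRrM.
by rewrite -{2}[ln n%:R](powRr1 (ltW ln_gt0)); congr (_ `^ _ * _ `^ _); lra.
Qed.

Lemma fN_ge1 : 1 <= f.
Proof.
have n1 : 1 <= n%:R :> R by rewrite ler1n (leq_trans _ n3).
rewrite -(ler_pXn2r (n := 3)) ?nnegrE ?(ltW fN_gt0)// fN_cube expr1n.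
by rewrite mulr_ege1 ?ln_ge1// exprn_ege1.
Qed.

Lemma fN_powRN (beta : R) : f `^ (- (2 * beta)) =
  n%:R `^ (- (4 * beta / 3)) * ln n%:R `^ (- (2 * beta / 3)).
Proof.
by rewrite /f /fN powRM ?powR_ge0// -!powRrM; congr (_ `^ _ * _ `^ _); lra.
Qed.

(** As f >= 1 and beta >= 1/4, f^(1 + 2 beta) >= f^(3/2) = n (ln n)^(1/2) >= n. *)
Lemma natr_fN_powRN_le (beta : R) : 1 / 4 <= beta -> n%:R * f `^ (- (2 * beta)) <= f.
Proof.
move=> b4; rewrite powRN ler_pdivrMr ?powR_gt0 ?fN_gt0//.
rewrite -{1}[f](powRr1 (ltW fN_gt0)) -powRD; last by apply/implyP => _; rewrite gt_eqF ?fN_gt0.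
apply: (@le_trans _ _ (f `^ (3 / 2))); last by apply: ler_powR; [exact: fN_ge1|lra].
rewrite powRrM powR12_sqrt ?powR_ge0// (powR_mulrn 3) ?(ltW fN_gt0)// fN_cube.
rewrite -[leLHS]ger0_norm ?(ltW n_gt0)// -sqrtr_sqr ler_sqrt.
  by rewrite ler_peMr ?exprn_ge0 ?(ltW n_gt0)// ln_ge1.
by rewrite mulr_ge0 ?exprn_ge0 ?(ltW n_gt0) ?(ltW ln_gt0).
Qed.

Variables alpha beta theta : R.
Hypotheses (alpha_gt0 : 0 < alpha) (beta_gt0 : 0 < beta) (theta_gt0 : 0 < theta).
Variable s : nat.
Hypotheses (s_ge : alpha * f <= s%:R) (ts_gt1 : 1 < theta * s%:R) (ts_le : theta * s%:R <= n%:R).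

Let s_gt0 : 0 < s%:R :> R.
Proof. by apply: lt_le_trans s_ge; rewrite mulr_gt0 ?fN_gt0. Qed.

Let gap_sqr : gap beta theta s ^+ 2 = beta * s%:R * ln (theta * s%:R).
Proof. by rewrite sqr_sqrtr// !mulr_ge0 ?(ltW beta_gt0)// ln_ge0// ltW. Qed.

(** By the choice of g, 2 g^2 / s = 2 beta ln(theta s), so the exponential is (theta s)^(-2 beta);
    then s >= alpha f. *)
Lemma gap_tail_le : expR (- (2 * gap beta theta s ^+ 2 / s%:R)) <=
  (alpha * theta) `^ (- (2 * beta)) * f `^ (- (2 * beta)).
Proof.
have ts_gt0 : 0 < theta * s%:R by rewrite mulr_gt0.
have at_gt0 : 0 < alpha * theta by rewrite mulr_gt0.
rewrite gap_sqr (_ : expR _ = (theta * s%:R) `^ (- (2 * beta))); last first.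
  by rewrite /powR gt_eqF//; congr expR; field; rewrite gt_eqF.
have atf_gt0 : 0 < alpha * theta * f by rewrite mulr_gt0// fN_gt0.
rewrite -powRM ?(ltW fN_gt0) ?(ltW at_gt0)// !powRN lef_pV2 ?posrE ?powR_gt0//.
apply: ge0_ler_powR; rewrite ?nnegrE ?(ltW atf_gt0) ?(ltW ts_gt0)//.
  by rewrite mulr_ge0// ltW.
by rewrite mulrAC mulrC ler_wpM2l// ltW.
Qed.

(** Squared, the left side is beta n^2 ln(theta s) / s <= beta n^2 ln n / (alpha f), which is (beta
    / alpha) f^2 because f^3 = n^2 ln n. *)
Lemma gap_rank_le : gap beta theta s * n%:R / s%:R <= Num.sqrt (beta / alpha) * f.
Proof.
have h0 : 0 <= gap beta theta s * n%:R / s%:R by rewrite divr_ge0 ?mulr_ge0 ?sqrtr_ge0// ltW.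
have r0 : 0 <= Num.sqrt (beta / alpha) * f by rewrite mulr_ge0 ?sqrtr_ge0// ltW// fN_gt0.
rewrite -(ler_pXn2r (n := 2)) ?nnegrE//.
rewrite [leLHS]exprMn [in leLHS]exprMn exprVn gap_sqr [leRHS]exprMn.
rewrite sqr_sqrtr ?divr_ge0 ?(ltW beta_gt0) ?(ltW alpha_gt0)//.
have -> : beta * s%:R * ln (theta * s%:R) * n%:R ^+ 2 / s%:R ^+ 2 =
    beta * n%:R ^+ 2 * ln (theta * s%:R) / s%:R by field; rewrite gt_eqF.
have -> : beta / alpha * f ^+ 2 = beta * n%:R ^+ 2 * ln n%:R / (alpha * f).
  rewrite -mulrA -(mulrA beta) -fN_cube; field; rewrite !gt_eqF ?fN_gt0//.
have lnle : ln (theta * s%:R) <= ln n%:R :> R.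
  by rewrite ler_ln ?posrE// (lt_trans _ ts_gt1).
have bn : 0 <= beta * n%:R ^+ 2 by rewrite mulr_ge0 ?exprn_ge0// ltW.
apply: ler_pM.
- by rewrite mulr_ge0// ln_ge0// ltW.
- by rewrite invr_ge0.
- by rewrite ler_wpM2l.
- by rewrite lef_pV2 ?posrE// mulr_gt0// fN_gt0.
Qed.

End GrowthRate.

(** * Union bound and expectation *)

Lemma sum_mem_le (R : numDomainType) (T : finType) (P : pred T) (b : {set T}) :
  \sum_(I | P I) (I \in b)%:R <= #|b|%:R :> R.
Proof.
rewrite -sum1_card natr_sum big_mkcond [leRHS]big_mkcond; apply: ler_sum => I _.
by case: (P I); case: (I \in b).
Qed.

Lemma ssizeE (R : realType) (alpha : R) (n : nat) : 0 <= alpha * fN n ->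
  (ssize alpha n < n - 1)%N ->
  alpha * fN n <= (ssize alpha n)%:R <= alpha * fN n + 1.
Proof.
move=> af0; rewrite /ssize subn1 gtn_min ltnn orbF => cn.
rewrite (minn_idPl (ltnW cn)) pmulrn gez0_abs; last first.
  by rewrite ceil_ge0 (lt_le_trans (ltrN10 R)).
rewrite ceil_ge/=; have := ceilB1_lt (alpha * fN n); rewrite intrB; lra.
Qed.

Theorem theorem5p1 (R : realType) (alpha beta theta gammaP : R)
  (halpha : 0 < alpha) (hbeta : 0 < beta) (htheta : 0 < theta)
  (hgammaP : 2 < gammaP)
  (d : Order.disp_t) (T : orderType d)
  (cost2 : seq T -> nat -> nat -> nat) (costR : seq T -> nat -> nat)
  (hcost2 : forall (S : seq T) (a b : nat),
      (1 <= a <= size S)%N -> (1 <= b <= size S)%N ->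
      (cost2 S a b)%:R <= 2 * gammaP * (size S)%:R)
  (hcostR : forall (Y : seq T) (i : nat), (1 <= i <= size Y)%N ->
      (costR Y i)%:R <= gammaP * (size Y)%:R)
  (n k : nat) (X : seq T) (hX : size X = n) (hk : (1 <= k <= n)%N)
  (hs : (ssize alpha n < n - 1)%N)
  (hts : 1 < theta * (ssize alpha n)%:R <= n%:R) :
  let s := ssize alpha n in
  let g := gap beta theta s in
  let c := select_count cost2 costR n k (idx_u n k s g) (idx_v n k s g) X in
  prob n s (fun I => (c I)%:R <= n%:R + (minn k (n - k))%:R
                                 + gammahat alpha beta gammaP n * fN n)
    >= 1 - 4 * (alpha * theta) `^ (- (2 * beta))
             * (n%:R) `^ (- (4 * beta / 3)) * (ln (n%:R : R)) `^ (- (2 * beta / 3))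
  /\
  (1 / 4 <= beta ->
   expect n s c <= n%:R + (minn k (n - k))%:R
      + (gammahat alpha beta gammaP n
         + (4 * gammaP + 2) * (alpha * theta) `^ (- (2 * beta))) * fN n).
Proof.
move=> s g c.
have /andP[ts_gt1 ts_le] := hts.
have s_gt0 : (0 < s)%N.
  rewrite lt0n; apply/eqP => s0; move: ts_gt1.
  by rewrite -/s s0 mulr0 ltr10.
have n3 : (3 <= n)%N by move: s_gt0 hs; rewrite -/s; clear; lia.
have g_ge0 : 0 <= g by exact: sqrtr_ge0.
have f_gt0 : 0 < fN n :> R by exact: fN_gt0.
have /andP[s_ge s_le] : alpha * fN n <= s%:R <= alpha * fN n + 1.
  by apply: ssizeE => //; rewrite mulr_ge0// ltW.
have [iuv ivs] := idx_bounds n k s g hk s_gt0 g_ge0.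
have gamma_ge0 : 0 <= gammaP by rewrite (le_trans _ (ltW hgammaP)).
have [ba [bb [bc [bd [bad_le cP]]]]] :=
  select_count_failure_sets gammaP cost2 costR gamma_ge0 hcost2 hcostR
    X n k s _ _ g hX iuv ivs hk g_ge0 (idx_u_ge n k s g) (idx_u_le n k s g)
    (idx_v_le n k s g hk s_gt0 g_ge0) (idx_v_ge n k s g hk s_gt0 g_ge0).
pose Q : R := (alpha * theta) `^ (- (2 * beta)) * fN n `^ (- (2 * beta)).
pose K : R := 'C(n, s)%:R.
have K_gt0 : 0 < K by rewrite ltr0n bin_gt0; move: hs; rewrite -/s; clear; lia.
have {}bad_le b : b \in [:: ba; bb; bc; bd] -> #|b|%:R <= K * Q.
  move=> /bad_le /le_trans; apply; rewrite ler_wpM2l ?(ltW K_gt0)//.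
  exact: gap_tail_le.
have bale : #|ba|%:R <= K * Q by apply: bad_le; rewrite !inE eqxx.
have bble : #|bb|%:R <= K * Q by apply: bad_le; rewrite !inE eqxx ?orbT.
have bcle : #|bc|%:R <= K * Q by apply: bad_le; rewrite !inE eqxx ?orbT.
have bdle : #|bd|%:R <= K * Q by apply: bad_le; rewrite !inE eqxx ?orbT.
set B : R := n%:R + _ + _.
(* Steps 2 and 3 contribute (2 gammaP - 1) s beyond n + min(k, n - k), with s <= alpha f + 1; the
   Delta terms of steps 3 and 4 add up to (4 gammaP + 2) Delta. *)
have {}cP (I : {set 'I_n}) : #|I| = s ->
    (c I)%:R <= B + n%:R * (((I \in bb)%:R + (I \in bd)%:R)
      + gammaP * ((I \in ba)%:R + (I \in bb)%:R + (I \in bc)%:R + (I \in bd)%:R)).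
  move=> /cP /le_trans; apply.
  have D_le : g * n%:R / s%:R <= Num.sqrt (beta / alpha) * fN n.
    exact: gap_rank_le.
  have gamD : (4 * gammaP + 2) * (g * n%:R / s%:R) <=
      (4 * gammaP + 2) * (Num.sqrt (beta / alpha) * fN n).
    by rewrite ler_wpM2l//; lra.
  have gams : (2 * gammaP - 1) * s%:R <= (2 * gammaP - 1) * (alpha * fN n + 1).
    by rewrite ler_wpM2l//; lra.
  have BE : B = n%:R + (minn k (n - k))%:R
      + (4 * gammaP + 2) * (Num.sqrt (beta / alpha) * fN n)
      + (2 * gammaP - 1) * (alpha * fN n + 1).
    by rewrite /B /gammahat; field; rewrite gt_eqF.
  by rewrite BE; lra.
split.
  rewrite (_ : 4 * _ * _ * _ = 4 * Q); last by rewrite /Q fN_powRN// !mulrA.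
  rewrite /prob ler_pdivlMr// -/K.
  set G := [set I | _].
  (* Outside the four failure sets the correction term vanishes, so the union bound applies. *)
  have sub : [set I : {set 'I_n} | #|I| == s] \subset G :|: ba :|: bb :|: bc :|: bd.
    apply/fintype.subsetP => I; rewrite !inE => cI; rewrite cI/=.
    have := cP I (eqP cI).
    case: (I \in ba); rewrite ?orbT//; case: (I \in bb); rewrite ?orbT//.
    case: (I \in bc); rewrite ?orbT//; case: (I \in bd); rewrite ?orbT//.
    by rewrite !addr0 mulr0 addr0 mulr0 addr0 => ->.
  have : ('C(n, s) <= #|G| + #|ba| + #|bb| + #|bc| + #|bd|)%N.
    rewrite -[X in 'C(X, _)]card_ord -card_draws; apply: leq_trans (subset_leq_card sub) _.
    by do 4!(apply: leq_trans (leq_card_setU _ _) _; rewrite leq_add2r).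
  by rewrite -(ler_nat R) !natrD -/K; lra.
move=> beta4; rewrite /expect ler_pdivrMr// -/K.
have sumP (b : {set {set 'I_n}}) := sum_mem_le R _ (fun I : {set 'I_n} => #|I| == s) b.
apply: (@le_trans _ _ (\sum_(I : {set 'I_n} | #|I| == s)
    (B + n%:R * (((I \in bb)%:R + (I \in bd)%:R)
      + gammaP * ((I \in ba)%:R + (I \in bb)%:R + (I \in bc)%:R + (I \in bd)%:R))))).
  by apply: ler_sum => I /eqP; exact: cP.
rewrite big_split/= sumr_const -mulr_sumr big_split/= -mulr_sumr !big_split/=.
rewrite (_ : #|_| = 'C(n, s)); last first.
  by rewrite -[in RHS](card_ord n) -card_draws; apply: eq_card => I; rewrite !inE.
rewrite -[_ *+ _]mulr_natr -/K.
(* Two failures are charged in step 3 and four in step 4, giving (4 gammaP + 2) n Q on average. *)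
apply: (@le_trans _ _ (B * K
    + n%:R * ((K * Q + K * Q) + gammaP * (K * Q + K * Q + K * Q + K * Q)))).
  rewrite lerD2l ler_wpM2l// lerD ?lerD// ?(le_trans (sumP _))//.
  by rewrite ler_wpM2l// !lerD ?(le_trans (sumP _)).
have nQ : n%:R * Q <= (alpha * theta) `^ (- (2 * beta)) * fN n.
  by rewrite /Q mulrCA ler_wpM2l ?powR_ge0 ?natr_fN_powRN_le.
have : (4 * gammaP + 2) * K * (n%:R * Q) <=
    (4 * gammaP + 2) * K * ((alpha * theta) `^ (- (2 * beta)) * fN n).
  by rewrite ler_wpM2l// mulr_ge0 ?(ltW K_gt0)//; lra.
by rewrite /B; lra.
Qed.
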